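(* For $i=1,2$ let $S_i:=\{c_i+A_ix:x\in\mathcal{B}\}$, where $c_i\in\mathbb{R}^N$ with $c_1\ne c_2$ and each $A_i$ is an $N\times N$ symmetric positive semidefinite matrix. Set $\zeta:=\|c_2-c_1\|_2$ and $e:=(c_1-c_2)/\|c_1-c_2\|_2$, and let $w_\cap$ denote the Gaussian width of $\mathbb{S}^{N-1}\cap\operatorname{cone}(S_1-S_2)$. If $\zeta>\|A_1e\|_2+\|A_2e\|_2$, then $$w_\cap\le\frac{\|A_1\|_F+\|A_2\|_F}{\zeta-\big(\|A_1e\|_2+\|A_2e\|_2\big)}+\frac{1}{\sqrt{2\pi}}.$$
   Context: $\mathcal{B}$ denotes the closed Euclidean unit ball in $\mathbb{R}^N$ centered at $0$, and $\mathbb{S}^{N-1}$ the unit sphere. $S_1-S_2:=\{u-v:u\in S_1,v\in S_2\}$ and $\operatorname{cone}(S_1-S_2):=\{tz:t\ge0,z\in S_1-S_2\}$. For a set $S\subseteq\mathbb{R}^N$, its Gaussian width is $w(S):=\mathbb{E}_g\big[\sup_{z\in S}\langle z,g\rangle\big]$, where $g$ has i.i.d. $\mathcal{N}(0,1)$ entries. $\|\cdot\|_F$ is the Frobenius norm. *)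

(* Defs.v *)
From HB Require Import structures.
From mathcomp Require Import all_boot all_order all_algebra.
From mathcomp Require Import all_classical all_reals all_analysis.
Set Implicit Arguments. Unset Strict Implicit. Unset Printing Implicit Defensive.
Import Order.TTheory GRing.Theory Num.Theory.
Local Open Scope classical_set_scope.
Local Open Scope ring_scope.

Section Defs.
Variable R : realType.

Definition dotv (N : nat) (u v : 'cV[R]_N) : R := \sum_(i < N) u i 0 * v i 0.
Definition norm2 (N : nat) (u : 'cV[R]_N) : R := Num.sqrt (dotv u u).

Definition frob (N : nat) (A : 'M[R]_N) : R :=
  Num.sqrt (\sum_(i < N) \sum_(j < N) A i j ^+ 2).

Definition sym_psd (N : nat) (A : 'M[R]_N) : Prop :=
  A^T = A /\ forall x : 'cV[R]_N, 0 <= dotv x (A *m x).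

Definition unit_ball (N : nat) : set 'cV[R]_N := [set x | norm2 x <= 1].
Definition unit_sphere (N : nat) : set 'cV[R]_N := [set x | norm2 x = 1].

Definition ellip (N : nat) (c : 'cV[R]_N) (A : 'M[R]_N) : set 'cV[R]_N :=
  [set c + A *m x | x in @unit_ball N].

Definition mdiff (N : nat) (S1 S2 : set 'cV[R]_N) : set 'cV[R]_N :=
  [set u - v | u in S1 & v in S2].
Definition cone (N : nat) (S : set 'cV[R]_N) : set 'cV[R]_N :=
  [set y | exists t : R, 0 <= t /\ exists2 z, S z & y = t *: z].

(* Expectation w.r.t. n i.i.d. standard Gaussian coordinates g_0, ..., g_{n-1},
   as an iterated Lebesgue integral against the standard normal density. *)
Fixpoint gauss_iter (n : nat) (F : (nat -> R) -> \bar R) : \bar R :=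
  match n with
  | 0 => F (fun _ => 0)
  | n'.+1 => (\int[lebesgue_measure]_(x in [set: R])
               ((normal_pdf 0 1 x)%:E *
                gauss_iter n' (fun g => F (fun i => if i == n' then x else g i))))%E
  end.

Definition gauss_exp (N : nat) (f : 'cV[R]_N -> \bar R) : \bar R :=
  gauss_iter N (fun g => f (\col_(i < N) g (nat_of_ord i))).

Definition gwidth (N : nat) (S : set 'cV[R]_N) : \bar R :=
  gauss_exp (fun g => ereal_sup [set (dotv z g)%:E | z in S]).

End Defs.

(* Main.v *)
Require Import Defs.
From HB Require Import structures.
From mathcomp Require Import all_boot all_order all_algebra.
From mathcomp Require Import all_classical all_reals all_analysis.
From mathcomp Require Import measurable_realfun ring lra.
Import Order.TTheory GRing.Theory Num.Theory.
Import numFieldNormedType.Exports.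
Local Open Scope classical_set_scope.
Local Open Scope ring_scope.

(** A unit vector z = t (zeta e + A1 x - A2 y) of the cone has <z, e> >= t D
    with D = zeta - (|A1 e| + |A2 e|), so t <= 1 / D and 0 <= <z, e> <= 1.
    Splitting g = <e, g> e + P g along e gives pointwise
      <z, g> <= max(0, <e, g>) + (|A1 P g| + |A2 P g|) / D.
    The first term has mean 1 / sqrt(2 pi); each norm is bounded through
    w <= (m + w^2 / m) / 2 with m slightly above the Frobenius norm.
    All terms are then functions of a single linear form <r, g>, and the
    iterated Gaussian integral of f(<r, g>) is the integral of f(|r| x) over one
    Gaussian variable x, by rotation of successive pairs of variables. *)

(** * Integrals against one standard Gaussian variable *)

Section gaussian_expectation.
Context {R : realType}.
Notation mu := (@lebesgue_measure R).
Notation phi := (@normal_pdf R 0 1).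

(* Without any measurability assumption: the integral is a supremum over the
   simple functions below the integrand. *)
Lemma le_integralT d (T : measurableType d) (nu : {measure set T -> \bar R})
    (f g : T -> \bar R) : (forall x, (f x <= g x)%E) ->
  (\int[nu]_(x in [set: T]) f x <= \int[nu]_(x in [set: T]) g x)%E.
Proof.
move=> fg; rewrite /integral !patch_setT; apply: leeB.
  apply: ereal_sup_le => _ [h hf <-]; apply: imageP => x.
  by apply: le_trans (hf x) _; rewrite !funeposE; apply: le_max2.
apply: ereal_sup_le => _ [h hf <-]; apply: imageP => x.
by apply: le_trans (hf x) _; rewrite !funenegE; apply: le_max2; rewrite ?leeN2.
Qed.

Definition gaussE (f : R -> \bar R) : \bar R :=
  (\int[mu]_(x in [set: R]) ((phi x)%:E * f x))%E.

Lemma phiE x : phi x = (Num.sqrt (2 * pi))^-1 * expR (- x ^+ 2 / 2).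
Proof.
rewrite normal_pdfE ?oner_neq0// /normal_peak /normal_fun expr1n subr0 mul1r.
by rewrite -mulr_natl.
Qed.

Lemma measurable_phi : measurable_fun [set: R] (EFin \o phi).
Proof. by apply/measurable_EFinP; exact: measurable_normal_pdf. Qed.

Lemma continuous_phi : continuous phi.
Proof. by apply: continuous_normal_pdf; rewrite oner_neq0. Qed.

Lemma phiN x : phi (- x) = phi x.
Proof. by rewrite !phiE sqrrN. Qed.

Lemma le_gaussE {f g : R -> \bar R} : (forall x, (f x <= g x)%E) ->
  (gaussE f <= gaussE g)%E.
Proof.
move=> fg; apply: le_integralT => x; apply: lee_wpmul2l => //.
by rewrite lee_fin normal_pdf_ge0.
Qed.

Lemma gaussE_ge0 (f : R -> \bar R) : (forall x, (0 <= f x)%E) ->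
  (0 <= gaussE f)%E.
Proof.
move=> f0; apply: integral_ge0 => x _; apply: mule_ge0 => //.
by rewrite lee_fin normal_pdf_ge0.
Qed.

Lemma gaussE_cst (c : R) : gaussE (fun=> c%:E) = c%:E.
Proof.
rewrite /gaussE integralZr//; last exact: integrable_normal_pdf.
by rewrite integral_normal_pdf mul1e.
Qed.

Lemma gaussED (f g : R -> \bar R) :
  measurable_fun [set: R] f -> measurable_fun [set: R] g ->
  (forall x, (0 <= f x)%E) -> (forall x, (0 <= g x)%E) ->
  gaussE (fun x => f x + g x)%E = (gaussE f + gaussE g)%E.
Proof.
move=> mf mg f0 g0; rewrite /gaussE -ge0_integralD//.
- by apply: eq_integral => x _; rewrite ge0_muleDr.
- by move=> x _; apply: mule_ge0 => //; rewrite lee_fin normal_pdf_ge0.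
- by apply: emeasurable_funM => //; exact: measurable_phi.
- by move=> x _; apply: mule_ge0 => //; rewrite lee_fin normal_pdf_ge0.
- by apply: emeasurable_funM => //; exact: measurable_phi.
Qed.

Lemma gaussEZl (k : R) (f : R -> \bar R) : 0 <= k ->
  measurable_fun [set: R] f -> (forall x, (0 <= f x)%E) ->
  gaussE (fun x => k%:E * f x)%E = (k%:E * gaussE f)%E.
Proof.
move=> k0 mf f0; rewrite /gaussE -ge0_integralZl_EFin//.
- by apply: eq_integral => x _; rewrite muleCA.
- by move=> x _; apply: mule_ge0 => //; rewrite lee_fin normal_pdf_ge0.
- by apply: emeasurable_funM => //; exact: measurable_phi.
Qed.

(** Both [phi] and Lebesgue measure are invariant under reflection. This removes the sign of a
    coefficient in [gaussE_rotation]. *)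
Lemma gaussE_oppr (f : R -> \bar R) : measurable_fun [set: R] f ->
  (forall x, (0 <= f x)%E) -> gaussE (fun x => f (- x)) = gaussE f.
Proof.
move=> mf f0; rewrite /gaussE.
under eq_integral do rewrite -phiN.
pose g x := ((phi x)%:E * f x)%E.
have mg : measurable_fun [set: R] g.
  by apply: emeasurable_funM => //; exact: measurable_phi.
transitivity (\int[pushforward mu (-%R : _ -> measurableTypeR R)]_(x in [set: R]) g x)%E.
  rewrite ge0_integral_pushforward//.
  by move=> x _; apply: mule_ge0 => //; rewrite lee_fin normal_pdf_ge0.
apply: eq_measure_integral => //= A mA _; exact: lebesgue_measureN.
Qed.

(* [1 + u x^2 <= exp (u x^2)], and [phi x * exp (u x^2)] is [s] times the
   centered normal density of deviation [s]; then [s] tends to 1. *)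
Lemma gaussE_sqr_le1 : (gaussE (fun x => (x ^+ 2)%:E) <= 1)%E.
Proof.
have m2 : measurable_fun [set: R] (fun x => (x ^+ 2)%:E).
  by apply/measurable_EFinP; exact: measurable_funX.
have p2 (x : R) : (0 <= (x ^+ 2)%:E)%E by rewrite lee_fin sqr_ge0.
(* From 1 + u E[x^2] <= s with u = (1 - s^-2) / 2, the quotient (s - 1) / u simplifies to 2 s^2 / (s
   + 1). *)
have key (s : R) : 1 < s -> (gaussE (fun x => (x ^+ 2)%:E) <= (2 * s ^+ 2 / (s + 1))%:E)%E.
  move=> s1; have s0 : 0 < s by apply: lt_trans s1.
  have sn0 : s != 0 by rewrite gt_eqF.
  pose u : R := (1 - s^-1 ^+ 2) / 2.
  have u0 : 0 < u.
    by rewrite divr_gt0// subr_gt0 exprn_ilt1// ?invr_ge0 ?ltW// invf_lt1.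
  have : (1 + u%:E * gaussE (fun x => (x ^+ 2)%:E) <= s%:E)%E.
    rewrite -(gaussEZl _ _ (ltW u0)) // -[X in (X + _)%E]gaussE_cst -gaussED//.
    - have -> : s%:E = (\int[mu]_(x in [set: R]) (s%:E * (normal_pdf 0 s x)%:E))%E.
        by rewrite integralZl ?integral_normal_pdf ?mule1//; exact: integrable_normal_pdf.
      rewrite /gaussE.
      apply: le_integralT => x; rewrite -!EFinM lee_fin phiE normal_pdfE//.
      rewrite /normal_peak /normal_fun subr0.
      have -> : Num.sqrt (s ^+ 2 * pi *+ 2) = s * Num.sqrt (2 * pi).
        by rewrite -mulrnAr sqrtrM ?sqr_ge0// sqrtr_sqr gtr0_norm// -mulr_natl.
      rewrite invfM !mulrA mulfV// mul1r -[leLHS]mulrA.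
      rewrite ler_wpM2l// ?invr_ge0 ?sqrtr_ge0//.
      have -> : expR (- x ^+ 2 / (s ^+ 2 *+ 2)) = expR (- x ^+ 2 / 2) * expR (u * x ^+ 2).
        rewrite -expRD; congr expR; rewrite /u -mulr_natl; field => //.
      rewrite ler_wpM2l ?expR_ge0//.
      by rewrite -mulrA; exact: expR_ge1Dx.
    - by apply: measurable_funeM.
    - by move=> x; rewrite mule_ge0// lee_fin ltW.
  (* The inequality just proved also rules out an infinite second moment. *)
  have := gaussE_ge0 _ p2; case: (gaussE _) => [e||]//=; last first.
    by rewrite mulry gtr0_sg// mul1e addey.
  move=> _; rewrite -EFinM -EFinD !lee_fin => H.
  rewrite ler_pdivlMr ?addr_gt0//.
  have : u * e <= s - 1 by lra.
  rewrite /u.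
  have -> : (1 - s^-1 ^+ 2) / 2 * e = (e * (s + 1)) * ((s - 1) / (2 * s ^+2)) by field.
  have c0 : 0 < (s - 1) / (2 * s ^+ 2) by rewrite divr_gt0 ?subr_gt0// mulr_gt0// exprn_gt0.
  move=> h; rewrite -(ler_pM2r c0); apply: le_trans h _.
  by rewrite le_eqVlt; apply/orP; left; apply/eqP; field.
apply/lee_addgt0Pr => d d0.
(* With s = 1 + w the bound 2 s^2 / (s + 1) is at most 1 + d as soon as 3 w + 2 w^2 <= 2 d + d w,
   which this w satisfies. *)
pose w : R := d / (2 + 2 * d).
have w0 : 0 < w by rewrite divr_gt0//; lra.
have wE : w * (2 + 2 * d) = d by rewrite /w divfK//; apply/eqP; lra.
have w1 : w < 1 by nra.
have t1 : 1 < 1 + w by rewrite ltrDl.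
apply: le_trans (key _ t1) _; rewrite -EFinD lee_fin.
rewrite ler_pdivrMr; last lra.
nra.
Qed.

(** This supplies the primitive for the first moment on a half-line. *)
Lemma derive_phi (x : R) : is_derive x 1 (fun x => - phi x) (x * phi x).
Proof.
have -> : (fun x => - phi x) =
    (fun x => - ((Num.sqrt (2 * pi))^-1 * expR (- x ^+ 2 / 2))).
  by apply/funext => y; rewrite phiE.
apply: is_derive_eq; rewrite phiE /GRing.scale/=.
set k := (Num.sqrt _)^-1; set e := expR _.
by field.
Qed.

Lemma cvgy_phi : phi x @[x --> +oo] --> (0 : R).
Proof.
have -> : phi = (fun x => (Num.sqrt (2 * pi))^-1 * gauss_fun (x / Num.sqrt 2)).
  apply/funext => x; rewrite phiE /gauss_fun expr_div_n sqr_sqrtr ?ler0n//.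
  by rewrite mulNr.
rewrite -[X in _ --> X](mulr0 (Num.sqrt (2 * pi))^-1).
apply: cvgM; first exact: cvg_cst.
apply: (cvg_comp (fun x => x / Num.sqrt 2) gauss_fun); last exact: cvg_gauss_fun.
by apply: gt0_cvgMly; [rewrite invr_gt0 sqrtr_gt0|exact: cvg_id].
Qed.

(** The negative half-line contributes nothing. On the other half the integrand is the derivative of
    [- phi], which vanishes at infinity, so the integral is [phi 0]. *)
Lemma gaussE_pos_part :
  gaussE (fun x => (Num.max 0 x)%:E) = ((Num.sqrt (2 * pi))^-1)%:E.
Proof.
pose f x := (phi x * Num.max 0 x)%:E.
transitivity (\int[mu]_(x in [set: R]) f x)%E.
  by apply: eq_integral => x _; rewrite /f EFinM.
transitivity (\int[mu]_(x in `[0%R, +oo[) f x)%E.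
  rewrite [RHS]integral_mkcond; apply: eq_integral => x _.
  rewrite patchE mem_setE in_itv/= andbT; case: ifPn => //.
  by rewrite -ltNge => /ltW x0; rewrite /f max_l// mulr0.
transitivity (\int[mu]_(x in `[0%R, +oo[) (x * phi x)%:E)%E.
  apply: eq_integral => x; rewrite inE/= in_itv/= andbT => x0.
  by rewrite /f max_r// mulrC.
have phi_derivable x : derivable (fun x => - phi x) x 1.
  by have [] := derive_phi x.
rewrite (@ge0_continuous_FTC2y _ _ (fun x => - phi x) 0 0).
- by rewrite sub0e -EFinN opprK phiE expr0n/= oppr0 mul0r expR0 mulr1.
- by move=> x x0; rewrite mulr_ge0// normal_pdf_ge0.
- apply: continuous_subspaceT => x; apply: cvgM; first exact: cvg_id.
  exact: continuous_phi.
- by rewrite -[X in _ --> X]oppr0; apply: cvgN; exact: cvgy_phi.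
- by move=> x _.
- apply: cvg_at_right_filter; apply: cvgN; exact: continuous_phi.
- by move=> x _; rewrite derive1E; have [] := derive_phi x.
Qed.

(** * Merging two Gaussian variables into one *)

Section ridge.
Variable f : R -> R.
Hypotheses (cf : continuous f) (f0 : forall x, 0 <= f x).

Let cf_affine (a s : R) : continuous (fun y => f (a + s * y)).
Proof.
move=> y; apply: (cvg_comp (fun y => a + s * y) f); last exact: cf.
by apply: cvgD; [exact: cvg_cst|apply: cvgM; [exact: cvg_cst|exact: cvg_id]].
Qed.

Let mf : measurable_fun [set: R] f.
Proof. exact: continuous_measurable_fun. Qed.

(** Tonelli's theorem gives measurability in the parameter; it makes the partial integrals of a
    ridge function measurable in [gauss_iter_ridge]. *)
Lemma measurable_gaussE_affine (s : R) :
  measurable_fun [set: R] (fun a => gaussE (fun y => (f (a + s * y))%:E)).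
Proof.
pose K (p : R * R) := (phi p.2 * f (p.1 + s * p.2))%:E.
have mK : measurable_fun [set: R * R] K.
  apply/measurable_EFinP; apply: measurable_funM.
    apply: (measurableT_comp (measurable_normal_pdf 0 1)).
    exact: measurable_snd.
  apply: (measurableT_comp mf); apply: measurable_funD; first exact: measurable_fst.
  by apply: measurable_funM => //; exact: measurable_snd.
apply: (eq_measurable_fun (fubini_F mu K)).
  by move=> a _; rewrite /fubini_F/gaussE; apply: eq_integral => y _; rewrite /K EFinM.
apply: measurable_fun_fubini_tonelli_F => // p.
by rewrite lee_fin mulr_ge0// normal_pdf_ge0.
Qed.

(* The rotation (x, y) -> z = (b x + s y) / t, followed by integrating out x. *)
Lemma gaussE_convolution (a b s : R) : 0 < s ->
  gaussE (fun x => gaussE (fun y => (f (a + b * x + s * y))%:E)) =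
  gaussE (fun z => (f (a + Num.sqrt (b ^+ 2 + s ^+ 2) * z))%:E).
Proof.
move=> s0; set t := Num.sqrt _.
have t0 : 0 < t by rewrite sqrtr_gt0 ltr_wpDl ?sqr_ge0// exprn_gt0.
have tE : t ^+ 2 = b ^+ 2 + s ^+ 2 by rewrite sqr_sqrtr// addr_ge0// sqr_ge0.
(* Integrand in (x, z) after substituting y = (t z - b x) / s at fixed x, with Jacobian t / s; now
   [f] sees only z. *)
pose K (p : R * R) := (phi p.1 * (phi ((t * p.2 - b * p.1) / s) *
  f (a + t * p.2) * (t / s)))%:E.
have K0 p : (0 <= K p)%E.
  by rewrite lee_fin !mulr_ge0// ?normal_pdf_ge0// ?invr_ge0 ltW.
have mK : measurable_fun [set: R * R] K.
  have mphi := measurable_normal_pdf (0 : R) 1.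
  have m1 := @measurable_fst _ _ R R.
  have m2 := @measurable_snd _ _ R R.
  apply/measurable_EFinP; apply: measurable_funM.
    exact: (measurableT_comp mphi).
  apply: measurable_funM => //; apply: measurable_funM.
    apply: (measurableT_comp mphi); apply: measurable_funM => //.
    by apply: measurable_funB; apply: measurable_funM.
  apply: (measurableT_comp mf); apply: measurable_funD => //.
  exact: measurable_funM.
transitivity (\int[mu]_(x in [set: R]) \int[mu]_(z in [set: R]) K (x, z))%E.
  apply: eq_integral => x _.
  pose F : R -> R := fun z => (z - b * x / t) * (t / s).
  have dF (z : R) : is_derive z 1 F (t / s).
    by apply: is_derive_eq; rewrite /GRing.scale/=; ring.
  have F'E : F^`()%classic = cst (t / s).
    by apply/funext => z; rewrite derive1E; have [] := dF z.
  have ts0 : 0 < t / s by rewrite divr_gt0.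
  pose G y := phi y * f (a + b * x + s * y).
  have -> : gaussE (fun y => (f (a + b * x + s * y))%:E) =
      (\int[mu]_(y in [set: R]) (G y)%:E)%E.
    by apply: eq_integral => y _; rewrite /G EFinM.
  rewrite (@increasing_ge0_integration_by_substitutionT _ F).
  - rewrite -ge0_integralZl_EFin ?normal_pdf_ge0//.
    + apply: eq_integral => z _; rewrite /K -EFinM; congr (_ * _)%:E.
      rewrite !fctE F'E /= /G; congr (phi _ * f _ * _).
        by rewrite /F; field; rewrite !gt_eqF.
      by rewrite /F; field; rewrite !gt_eqF.
    + move=> z _; rewrite lee_fin F'E/= mulr_ge0// ?(ltW ts0)// /G.
      by rewrite /= mulr_ge0// normal_pdf_ge0.
    + apply/measurable_EFinP; rewrite F'E; apply: measurable_funM => //.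
      apply: measurableT_comp => //; last first.
        by apply: measurable_funM => //; apply: measurable_funB.
      apply: measurable_funM; first exact: measurable_normal_pdf.
      apply: continuous_measurable_fun; exact: cf_affine.
  - by move=> y z yz; rewrite /F /= ltr_pM2r// ltrD2r.
  - by rewrite F'E => z; exact: cvg_cst.
  - by rewrite F'E; exact: is_cvg_cst.
  - by rewrite F'E; exact: is_cvg_cst.
  - by move=> z; have [] := dF z.
  - by apply: gt0_cvgMlNy => //; exact: cvg_addrr_Ny.
  - by apply: gt0_cvgMly => //; exact: cvg_addrr.
  - move=> y; apply: cvgM; first exact: continuous_phi.
    exact: cf_affine.
  - by move=> y; rewrite mulr_ge0// normal_pdf_ge0.
rewrite fubini_tonelli//; apply: eq_integral => z _.
have st0 : s / t != 0 by rewrite gt_eqF// divr_gt0.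
(* Completing the square in x: x^2 + (t z - b x)^2 / s^2 = z^2 + (x - b z / t)^2 t^2 / s^2. Hence x
   carries a normal density of mean b z / t and deviation s / t, whose integral is 1. *)
transitivity (\int[mu]_(x in [set: R])
    ((phi z * f (a + t * z))%:E * (normal_pdf (b * z / t) (s / t) x)%:E))%E.
  apply: eq_integral => x _; rewrite /K/= -EFinM; congr EFin.
  rewrite !phiE normal_pdfE// /normal_peak /normal_fun.
  have -> : Num.sqrt ((s / t) ^+ 2 * pi *+ 2) = s / t * Num.sqrt (2 * pi).
    rewrite -mulrnAr sqrtrM ?sqr_ge0// sqrtr_sqr gtr0_norm ?divr_gt0//.
    by rewrite -mulr_natl.
  set k := (Num.sqrt _)^-1; rewrite invfM invf_div -/k.
  transitivity (k * k * (t / s) * f (a + t * z) * (expR (- x ^+ 2 / 2) *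
     expR (- ((t * z - b * x) / s) ^+ 2 / 2))); first by ring.
  transitivity (k * k * (t / s) * f (a + t * z) * (expR (- z ^+ 2 / 2) *
     expR (- (x - b * z / t) ^+ 2 / ((s / t) ^+ 2 *+ 2)))); last by ring.
  rewrite -!expRD; congr (_ * expR _).
  have -> : (s / t) ^+ 2 *+ 2 = 2 * s ^+ 2 / t ^+ 2.
    by rewrite -mulr_natl expr_div_n mulrA.
  have b2 : b ^+ 2 = t ^+ 2 - s ^+ 2 by rewrite tE addrK.
  transitivity (- (x ^+ 2 * (s ^+ 2 + b ^+ 2) + t ^+ 2 * z ^+ 2 - 2 * t * z * b * x)
     / (2 * s ^+ 2)); first by field; rewrite gt_eqF.
  transitivity (- (x ^+ 2 * t ^+ 2 + (s ^+ 2 + b ^+ 2) * z ^+ 2 - 2 * t * z * b * x)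
     / (2 * s ^+ 2)); last by field; rewrite !gt_eqF.
  by rewrite b2; field; rewrite gt_eqF.
rewrite integralZl//; last exact: integrable_normal_pdf.
by rewrite integral_normal_pdf mule1 EFinM.
Qed.

(** The case s = 0 escapes the substitution, which divides by s. There y disappears, and b is
    replaced by |b| through reflection. *)
Lemma gaussE_rotation (a b s : R) : 0 <= s ->
  gaussE (fun x => gaussE (fun y => (f (a + b * x + s * y))%:E)) =
  gaussE (fun z => (f (a + Num.sqrt (b ^+ 2 + s ^+ 2) * z))%:E).
Proof.
rewrite le_eqVlt => /orP[/eqP <-|]; last exact: gaussE_convolution.
rewrite expr0n/= addr0 sqrtr_sqr.
transitivity (gaussE (fun x => (f (a + b * x))%:E)).
  congr gaussE; apply/funext => x; rewrite -[RHS]gaussE_cst.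
  by congr gaussE; apply/funext => y; rewrite mul0r addr0.
case: (ger0P b) => // b0.
rewrite -(gaussE_oppr (fun x => (f (a + b * x))%:E)).
- by congr gaussE; apply/funext => x; rewrite mulrN mulNr.
- apply/measurable_EFinP; apply: continuous_measurable_fun; exact: cf_affine.
- by move=> x; rewrite lee_fin.
Qed.

End ridge.

(** * Iterated Gaussian integrals *)

(** Measurability one level at a time: each partial integral is measurable in the next variable to
    integrate, which is what additivity via [gaussED] asks. It stands in for joint measurability on
    a product space. *)
Fixpoint iter_measurable (n : nat) (F : (nat -> R) -> \bar R) : Prop :=
  match n with
  | 0 => True
  | n'.+1 =>
    let F' x g := F (fun i => if i == n' then x else g i) in
    (forall x, iter_measurable n' (F' x)) /\
    measurable_fun [set: R] (fun x => gauss_iter n' (F' x))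
  end.

Lemma gauss_iterS n (F : (nat -> R) -> \bar R) : gauss_iter n.+1 F =
  gaussE (fun x => gauss_iter n (fun g => F (fun i => if i == n then x else g i))).
Proof. by []. Qed.

Lemma le_gauss_iter n (F G : (nat -> R) -> \bar R) :
  (forall g, (F g <= G g)%E) -> (gauss_iter n F <= gauss_iter n G)%E.
Proof.
elim: n F G => [|n IHn] F G FG; first exact: FG.
by rewrite !gauss_iterS; apply: le_gaussE => x; apply: IHn => g.
Qed.

Lemma gauss_iter_ge0 n (F : (nat -> R) -> \bar R) :
  (forall g, (0 <= F g)%E) -> (0 <= gauss_iter n F)%E.
Proof.
elim: n F => [|n IHn] F F0; first exact: F0.
by rewrite gauss_iterS; apply: gaussE_ge0 => x; apply: IHn => g.
Qed.

(** The two conclusions go through one induction: a partial integral of the sum is measurable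
    because it equals the sum of the partial integrals. *)
Lemma gauss_iterD n (F G : (nat -> R) -> \bar R) :
  (forall g, (0 <= F g)%E) -> (forall g, (0 <= G g)%E) ->
  iter_measurable n F -> iter_measurable n G ->
  iter_measurable n (fun g => F g + G g)%E /\
  gauss_iter n (fun g => F g + G g)%E = (gauss_iter n F + gauss_iter n G)%E.
Proof.
elim: n F G => [|n IHn] F G F0 G0 //= [mF mF'] [mG mG'].
have IH x := IHn _ _ (fun g => F0 (fun i => if i == n then x else g i))
  (fun g => G0 (fun i => if i == n then x else g i)) (mF x) (mG x).
have E : (fun x => gauss_iter n (fun g =>
      F (fun i => if i == n then x else g i) +
      G (fun i => if i == n then x else g i)))%E =
    (fun x => gauss_iter n (fun g => F (fun i => if i == n then x else g i)) +
      gauss_iter n (fun g => G (fun i => if i == n then x else g i)))%E.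
  by apply/funext => x; have [] := IH x.
split; first split.
- by move=> x; have [] := IH x.
- by rewrite E; exact: emeasurable_funD.
- rewrite -!/(gauss_iter n.+1 _) !gauss_iterS -gaussED//; last 2 first.
  + by move=> x; exact: gauss_iter_ge0.
  + by move=> x; exact: gauss_iter_ge0.
  by congr gaussE.
Qed.

Lemma gauss_iter0 n : iter_measurable n (fun=> 0%E) /\
  gauss_iter n (fun=> 0%E) = 0%E :> \bar R.
Proof.
elim: n => [|n [IHm IHe]] //; split; last by rewrite gauss_iterS IHe gaussE_cst.
split=> [x|]; first exact: IHm.
by apply: (eq_measurable_fun (cst 0%E)) => // x _; rewrite IHe.
Qed.

Lemma gauss_iter_sum n (I : Type) (s : seq I) (F : I -> (nat -> R) -> \bar R) :
  (forall i g, (0 <= F i g)%E) -> (forall i, iter_measurable n (F i)) ->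
  iter_measurable n (fun g => \sum_(i <- s) F i g)%E /\
  gauss_iter n (fun g => \sum_(i <- s) F i g)%E = (\sum_(i <- s) gauss_iter n (F i))%E.
Proof.
move=> F0 mF; elim: s => [|i s [IHm IHe]].
  under [in X in X /\ _]eq_fun do rewrite big_nil.
  under [in X in _ /\ X]eq_fun do rewrite big_nil.
  rewrite big_nil.
  exact: gauss_iter0.
under [in X in X /\ _]eq_fun do rewrite big_cons.
under [in X in _ /\ X]eq_fun do rewrite big_cons.
rewrite big_cons -IHe; apply: gauss_iterD => // g.
exact: sume_ge0.
Qed.

(** Induction on [n] with [a] free: the outermost variable is absorbed into the shift, the inner
    ones collapse to a single Gaussian of deviation [s], and [gaussE_rotation] merges the two. *)
Lemma gauss_iter_ridge (f : R -> R) n (r : 'I_n -> R) (a : R) :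
  continuous f -> (forall x, 0 <= f x) ->
  let F := fun g : nat -> R => (f (a + \sum_(i < n) r i * g i))%:E in
  iter_measurable n F /\
  gauss_iter n F =
    gaussE (fun z => (f (a + Num.sqrt (\sum_(i < n) r i ^+ 2) * z))%:E).
Proof.
move=> cf f0 /=; elim: n r a => [|n IHn] r a.
  split=> //=; rewrite !big_ord0 sqrtr0 -[LHS]gaussE_cst.
  by congr gaussE; apply/funext => z; rewrite mul0r.
have E x : (fun g : nat -> R =>
      (f (a + \sum_(i < n.+1) r i * (if i == n :> nat then x else g i)))%:E) =
    (fun g : nat -> R =>
      (f ((a + r ord_max * x) + \sum_(i < n) r (widen_ord (leqnSn n) i) * g i))%:E).
  apply/funext => g; congr (f _)%:E; rewrite big_ord_recr/= eqxx addrA.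
  rewrite addrAC; congr (_ + _ + _); apply: eq_bigr => i _.
  by rewrite ltn_eqF.
have IH x := IHn (fun i => r (widen_ord (leqnSn n) i)) (a + r ord_max * x).
set s := Num.sqrt (\sum_(i < n) r (widen_ord (leqnSn n) i) ^+ 2) in IH.
split; first split => /=.
- by move=> x; rewrite E; have [] := IH x.
- have -> : (fun x => gauss_iter n (fun g : nat -> R =>
        (f (a + \sum_(i < n.+1) r i * (if i == n :> nat then x else g i)))%:E)) =
      (fun b => gaussE (fun y => (f (b + s * y))%:E)) \o (fun x => a + r ord_max * x).
    by apply/funext => x /=; rewrite E; have [] := IH x.
  apply: measurableT_comp; first exact: measurable_gaussE_affine.
  by apply: measurable_funD => //; exact: measurable_funM.
- rewrite gauss_iterS.
  under eq_fun do rewrite E (IH _).2.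
  rewrite gaussE_rotation ?sqrtr_ge0//.
  rewrite sqr_sqrtr; last by apply: sumr_ge0 => i _; exact: sqr_ge0.
  by rewrite [in RHS]big_ord_recr/= [in RHS]addrC.
Qed.

End gaussian_expectation.

(** * An integrable majorant of the norm of a Gaussian image *)

(** The norm is not a function of one linear form, but its square is a sum of squares of such forms,
    one per row of [M]. The majorant [G] is this sum, weighted, plus a constant. *)
Lemma gauss_iter_norm2_majorant {R : realType} n (M : 'M[R]_n) (k d : R) : 0 <= k -> 0 < d ->
  exists G : (nat -> R) -> \bar R,
    [/\ forall g : nat -> R,
          ((k * norm2 (M *m \col_(i < n) g (nat_of_ord i)))%:E <= G g)%E,
        forall g, (0 <= G g)%E,
        iter_measurable n G &
        (gauss_iter n G <= (k * (frob M + d))%:E)%E].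
Proof.
move=> k0 d0; have F0 : 0 <= frob M by exact: sqrtr_ge0.
(* The slack [d] keeps [m] positive even when M = 0, so that division by [m] is legitimate. *)
set m := frob M + d; have m0 : 0 < m by rewrite ltr_wpDl.
pose c := k / (2 * m); have c0 : 0 <= c by rewrite divr_ge0// mulr_ge0// ltW.
pose h x : R := c * x ^+ 2.
have h0 x : 0 <= h x by rewrite mulr_ge0// sqr_ge0.
have ch : continuous h.
  move=> x; apply: cvgM; first exact: cvg_cst.
  exact: exprn_continuous.
pose H i (g : nat -> R) := (h (0 + \sum_(j < n) M i j * g j))%:E.
have [mH HE] := gauss_iter_sum n _ (index_enum 'I_n) H
  (fun i g => h0 _) (fun i => (gauss_iter_ridge h n (M i) 0 ch h0).1).
pose C := k * m / 2; have C0 : 0 <= C by rewrite divr_ge0// mulr_ge0// ltW.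
(* The constant is handled as a ridge function with zero coefficients. *)
have [mC CE] := gauss_iter_ridge (cst C) n (fun=> 0) 0
  (fun x => cvg_cst C) (fun=> C0).
have [] := gauss_iterD n _ (fun=> C%:E) _ _ mH mC.
- by move=> g; apply: sume_ge0 => i _; rewrite lee_fin.
- by move=> g; rewrite lee_fin.
move=> mG GE; eexists; split; [| |exact: mG|].
- move=> g; set w := norm2 _.
  have -> : (\sum_(i < n) H i g = (c * w ^+ 2)%:E)%E.
    rewrite sumEFin /w /norm2 sqr_sqrtr; last first.
      by apply: sumr_ge0 => i _; rewrite -expr2 sqr_ge0.
    rewrite mulr_sumr; congr EFin; apply: eq_bigr => i _.
    rewrite /h add0r -expr2 mxE; congr (_ * _ ^+ 2).
    by apply: eq_bigr => j _; rewrite mxE.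
  rewrite -EFinD lee_fin -subr_ge0.
  (* The choices c = k / (2 m) and C = k m / 2 make the gap a perfect square, with equality at w =
     m. *)
  have -> : c * w ^+ 2 + C - k * w = c * (w - m) ^+ 2.
    by rewrite /c /C; field; rewrite gt_eqF.
  by rewrite mulr_ge0// sqr_ge0.
- by move=> g; rewrite adde_ge0// sume_ge0// => i _; rewrite lee_fin.
rewrite GE HE CE /= gaussE_cst.
apply: (@le_trans _ _ (\sum_(i < n) (c * \sum_(j < n) M i j ^+ 2)%:E + C%:E)%E).
  apply: leeD => //; apply: lee_sum => i _.
  (* Each row has mean square at most its squared norm, and these sum to the squared Frobenius
     norm. *)
  rewrite (gauss_iter_ridge h n (M i) 0 ch h0).2.
  set s := Num.sqrt _; have s2 : s ^+ 2 = \sum_(j < n) M i j ^+ 2.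
    by rewrite sqr_sqrtr// sumr_ge0// => j _; exact: sqr_ge0.
  rewrite -s2; have cs0 : 0 <= c * s ^+ 2 by rewrite mulr_ge0// sqr_ge0.
  have -> : gaussE (fun z => (h (0 + s * z))%:E) =
      gaussE (fun z => (c * s ^+ 2)%:E * (z ^+ 2)%:E)%E.
    congr gaussE; apply/funext => z.
    by rewrite /h add0r exprMn mulrA EFinM.
  rewrite gaussEZl//.
  - by rewrite -[leRHS]mule1 lee_wpmul2l//; exact: gaussE_sqr_le1.
  - by apply/measurable_EFinP; exact: measurable_funX.
  - by move=> x; rewrite lee_fin sqr_ge0.
rewrite sumEFin -EFinD lee_fin -mulr_sumr.
have -> : \sum_(i < n) \sum_(j < n) M i j ^+ 2 = frob M ^+ 2.
  rewrite sqr_sqrtr// sumr_ge0// => i _; apply: sumr_ge0 => j _.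
  exact: sqr_ge0.
rewrite -subr_ge0.
have -> : k * m - (c * frob M ^+ 2 + C) = c * (m ^+ 2 - frob M ^+ 2).
  by rewrite /c /C; field; rewrite gt_eqF.
rewrite mulr_ge0// subr_ge0 ler_pXn2r ?nnegrE ?(ltW m0)//.
by rewrite /m lerDl ltW.
Qed.

(** * Euclidean geometry and the pointwise bound on the cone *)

Section euclidean.
Context {R : realType} {N : nat}.
Implicit Types (u v w : 'cV[R]_N) (A : 'M[R]_N).

Lemma dotvE u v : dotv u v = (u^T *m v) 0 0.
Proof. by rewrite mxE; apply: eq_bigr => i _; rewrite mxE. Qed.

Lemma dotvC u v : dotv u v = dotv v u.
Proof. by apply: eq_bigr => i _; rewrite mulrC. Qed.

Lemma dotvDr u v w : dotv u (v + w) = dotv u v + dotv u w.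
Proof. by rewrite !dotvE mulmxDr mxE. Qed.

Lemma dotvNr u v : dotv u (- v) = - dotv u v.
Proof. by rewrite !dotvE mulmxN mxE. Qed.

Lemma dotvZr (a : R) u v : dotv u (a *: v) = a * dotv u v.
Proof. by rewrite !dotvE -scalemxAr mxE. Qed.

Lemma dotvDl u v w : dotv (u + v) w = dotv u w + dotv v w.
Proof. by rewrite dotvC dotvDr !(dotvC w). Qed.

Lemma dotvNl u v : dotv (- u) v = - dotv u v.
Proof. by rewrite dotvC dotvNr dotvC. Qed.

Lemma dotvZl (a : R) u v : dotv (a *: u) v = a * dotv u v.
Proof. by rewrite dotvC dotvZr dotvC. Qed.

Lemma dotv_mulmxl A u v : dotv (A *m u) v = dotv u (A^T *m v).
Proof. by rewrite !dotvE trmx_mul mulmxA. Qed.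

Lemma dotvv_ge0 u : 0 <= dotv u u.
Proof. by apply: sumr_ge0 => i _; rewrite -expr2 sqr_ge0. Qed.

Lemma sqr_norm2 u : norm2 u ^+ 2 = dotv u u.
Proof. by rewrite sqr_sqrtr// dotvv_ge0. Qed.

Lemma norm2_ge0 u : 0 <= norm2 u.
Proof. exact: sqrtr_ge0. Qed.

Lemma norm2_eq0 u : norm2 u = 0 -> u = 0.
Proof.
move=> u0; have : dotv u u = 0 by rewrite -sqr_norm2 u0 expr0n.
move/eqP; rewrite psumr_eq0 => [|i _]; last by rewrite -expr2 sqr_ge0.
move=> /allP H; apply/matrixP => i j; rewrite ord1 mxE; apply/eqP.
by have := H i (mem_index_enum _); rewrite mulf_eq0 orbb.
Qed.

Lemma norm2N u : norm2 (- u) = norm2 u.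
Proof. by rewrite /norm2 dotvNl dotvNr opprK. Qed.

(** Cauchy-Schwarz: the squared norm of |v| u - |u| v is 2 |u| |v| (|u| |v| - <u, v>). Zero vectors
    are set apart so that the factor can be cancelled. *)
Lemma dotv_le_norm2 u v : dotv u v <= norm2 u * norm2 v.
Proof.
have := norm2_ge0 u; rewrite le_eqVlt => /orP[/eqP u0|u0].
  by rewrite -u0 mul0r (norm2_eq0 _ (esym u0)) dotvE trmx0 mul0mx mxE.
have := norm2_ge0 v; rewrite le_eqVlt => /orP[/eqP v0|v0].
  by rewrite -v0 mulr0 (norm2_eq0 _ (esym v0)) dotvE mulmx0 mxE.
have := dotvv_ge0 (norm2 v *: u - norm2 u *: v).
rewrite !(dotvDl, dotvDr, dotvNl, dotvNr, dotvZl, dotvZr) -!sqr_norm2 (dotvC v u).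
set a := norm2 u in u0 *; set b := norm2 v in v0 *; set p := dotv u v.
have ab : 0 < 2 * (a * b) by rewrite !mulr_gt0.
move=> H; rewrite -subr_ge0 -(pmulr_rge0 _ ab).
by apply: le_trans H _; rewrite le_eqVlt; apply/orP; left; apply/eqP; ring.
Qed.

Lemma dotv_ge_Nnorm2 u v : - (norm2 u * norm2 v) <= dotv u v.
Proof. by rewrite lerNl -dotvNl -(norm2N u) dotv_le_norm2. Qed.

(** The matrix is A P with P the projection orthogonal to [e]; by Pythagoras each row loses the
    square of its component [p] along [e]. *)
Lemma frob_sub_proj A (e : 'cV[R]_N) : norm2 e = 1 ->
  frob (A - A *m e *m e^T) <= frob A.
Proof.
move=> e1; rewrite ler_wsqrtr//; apply: ler_sum => i _.
have ee : \sum_(j < N) e j 0 ^+ 2 = 1.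
  transitivity (dotv e e); last by rewrite -sqr_norm2 e1 expr1n.
  by apply: eq_bigr => j _; rewrite expr2.
pose p := (A *m e) i 0.
have -> : \sum_(j < N) (A - A *m e *m e^T) i j ^+ 2 =
    \sum_(j < N) A i j ^+ 2 - p ^+ 2.
  transitivity (\sum_(j < N) (A i j ^+ 2 - 2 * p * (A i j * e j 0) +
      p ^+ 2 * e j 0 ^+ 2)).
    apply: eq_bigr => j _; rewrite !mxE big_ord1 !mxE -/p.
    have -> : \sum_(j0 < N) A i j0 * e j0 0 = p by rewrite /p mxE.
    ring.
  rewrite big_split/= -mulr_sumr ee sumrB -mulr_sumr.
  have -> : \sum_(j < N) A i j * e j 0 = p by rewrite /p mxE.
  by ring.
by rewrite gerBl sqr_ge0.
Qed.

(** Pairing [z] with [e] bounds the scale [t]. Since c1 - c2 is parallel to [e], the centers do not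
    contribute to the pairing of [z] with P g. *)
Lemma support_cone_bound (c1 c2 : 'cV[R]_N) (A1 A2 : 'M[R]_N) (zeta : R)
    (e z g : 'cV[R]_N) :
  A1^T = A1 -> A2^T = A2 -> c1 - c2 = zeta *: e -> norm2 e = 1 ->
  let D := zeta - (norm2 (A1 *m e) + norm2 (A2 *m e)) in
  0 < D ->
  (@unit_sphere R N `&` cone (mdiff (ellip c1 A1) (ellip c2 A2))) z ->
  dotv z g <= Num.max 0 (dotv e g) +
    (D^-1 * norm2 ((A1 - A1 *m e *m e^T) *m g) +
     D^-1 * norm2 ((A2 - A2 *m e *m e^T) *m g)).
Proof.
move=> A1T A2T cE e1 /= D0 [z1 [t [t0 [_ [_ [x x1 <-] [_ [y y1 <-] <-]] zE]]]].
set D := (D in 0 < D) in D0 *.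
have {}zE : z = t *: (zeta *: e + A1 *m x - A2 *m y).
  by rewrite zE -cE opprD addrACA addrA.
have ee : dotv e e = 1 by rewrite -sqr_norm2 e1 expr1n.
(* Symmetry moves [A] onto [w], then Cauchy-Schwarz applies. *)
have norm_ball (A : 'M[R]_N) v w : A^T = A -> norm2 v <= 1 ->
    `|dotv (A *m v) w| <= norm2 (A *m w).
  move=> AT v1; rewrite dotv_mulmxl AT.
  have h : norm2 v * norm2 (A *m w) <= norm2 (A *m w).
    by rewrite ler_piMl// norm2_ge0.
  rewrite ler_norml (le_trans _ (dotv_ge_Nnorm2 _ _)) ?lerN2//.
  by rewrite (le_trans (dotv_le_norm2 _ _)).
have MgE (A : 'M[R]_N) : (A - A *m e *m e^T) *m g = A *m (g - dotv e g *: e).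
  rewrite mulmxBl mulmxBr; congr (_ - _); rewrite -[LHS]mulmxA.
  by rewrite [e^T *m g]mx11_scalar -dotvE mul_mx_scalar scalemxAr.
rewrite !MgE; set h := g - _.
have eh : dotv e h = 0 by rewrite dotvDr dotvNr dotvZr ee mulr1 subrr.
pose p := dotv z e.
have gE : dotv z g = dotv z h + p * dotv e g.
  by rewrite /h dotvDr dotvNr dotvZr mulrC subrK.
have p1 : p <= 1 by have := dotv_le_norm2 z e; rewrite z1 e1 mulr1.
have tDp : t * D <= p.
  rewrite /p zE dotvZl ler_wpM2l// !dotvDl dotvNl dotvZl ee mulr1.
  have := norm_ball _ _ e A1T x1; have := norm_ball _ _ e A2T y1.
  rewrite !ler_norml /D => /andP[_ ?] /andP[? _]; lra.
have p0 : 0 <= p by apply: le_trans tDp; rewrite mulr_ge0// ltW.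
have tD : t <= D^-1 by rewrite -[D^-1]mul1r ler_pdivlMr// (le_trans tDp).
rewrite gE addrC lerD//.
  (* A nonnegative <e, g> uses p <= 1, a negative one uses p >= 0. *)
  have [|] := lerP 0 (dotv e g) => eg; first by rewrite ler_piMl.
  by rewrite mulr_ge0_le0// ltW.
rewrite zE dotvZl -mulrDr !dotvDl dotvNl dotvZl eh mulr0 add0r.
have := norm_ball _ _ h A1T x1; have := norm_ball _ _ h A2T y1.
rewrite !ler_norml => /andP[h2 _] /andP[_ h1].
apply: le_trans (_ : t * (norm2 (A1 *m h) + norm2 (A2 *m h)) <= _).
  by rewrite ler_wpM2l//; lra.
by rewrite ler_wpM2r// addr_ge0// norm2_ge0.
Qed.

End euclidean.

(** * Integrating the pointwise bound *)

Theorem theorem2 (R : realType) (N : nat) (c1 c2 : 'cV[R]_N) (A1 A2 : 'M[R]_N) :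
  c1 != c2 -> sym_psd A1 -> sym_psd A2 ->
  let zeta := norm2 (c2 - c1) in
  let e := (norm2 (c1 - c2))^-1 *: (c1 - c2) in
  let S1 := ellip c1 A1 in
  let S2 := ellip c2 A2 in
  let w_cap := gwidth (@unit_sphere R N `&` cone (mdiff S1 S2)) in
  norm2 (A1 *m e) + norm2 (A2 *m e) < zeta ->
  (w_cap <= ((frob A1 + frob A2) / (zeta - (norm2 (A1 *m e) + norm2 (A2 *m e)))
             + (Num.sqrt (2 * pi))^-1)%:E)%E.
Proof.
move=> c12 [A1T _] [A2T _] zeta e S1 S2 w_cap; rewrite -subr_gt0.
set D := zeta - _ => D0.
have zetaE : zeta = norm2 (c1 - c2) by rewrite /zeta -norm2N opprB.
have zeta_neq0 : zeta != 0.
  by apply: contra c12 => /eqP; rewrite zetaE => /norm2_eq0/eqP; rewrite subr_eq0.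
have cE : c1 - c2 = zeta *: e by rewrite /e -zetaE scalerA mulfV// scale1r.
have e1 : norm2 e = 1.
  apply/eqP; rewrite -sqrp_eq1 ?norm2_ge0// sqr_norm2 /e dotvZl dotvZr -sqr_norm2.
  by rewrite -zetaE; apply/eqP; field.
have k0 : 0 <= D^-1 by rewrite invr_ge0 ltW.
apply/lee_addgt0Pr => eps eps0.
(* Each of the two majorants exceeds its target by d / D = eps / 2. *)
pose d := eps * D / 2; have d0 : 0 < d by rewrite divr_gt0// mulr_gt0.
have [G1 [leG1 G1_ge0 mG1 intG1]] :=
  gauss_iter_norm2_majorant N (A1 - A1 *m e *m e^T) _ _ k0 d0.
have [G2 [leG2 G2_ge0 mG2 intG2]] :=
  gauss_iter_norm2_majorant N (A2 - A2 *m e *m e^T) _ _ k0 d0.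
have [mG G_int] := gauss_iterD N G1 G2 G1_ge0 G2_ge0 mG1 mG2.
have max_ge0 (x : R) : 0 <= Num.max 0 x by rewrite le_max lexx.
have max_cont : continuous (fun x : R => Num.max 0 x).
  by move=> x; apply: continuous_max; [exact: cvg_cst|exact: cvg_id].
have [mP P_int] := gauss_iter_ridge _ N (fun i => e i 0) 0 max_cont max_ge0.
have [|_ sum_int] := gauss_iterD N _ _ _
    (fun g => adde_ge0 (G1_ge0 g) (G2_ge0 g)) mP mG.
  by move=> g; rewrite lee_fin max_ge0.
rewrite /w_cap /gwidth /gauss_exp.
pose G g := ((Num.max 0 (0 + \sum_(i < N) e i 0 * g (nat_of_ord i)))%:E +
  (G1 g + G2 g))%E.
(* Monotonicity holds without measurability, so nothing has to be shown about the supremum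
   itself. *)
apply: le_trans (le_gauss_iter N _ G _) _.
- move=> g; apply: ge_ereal_sup => _ [z zS <-].
  have := support_cone_bound c1 c2 A1 A2 zeta e z (\col_(i < N) g (nat_of_ord i))
    A1T A2T cE e1 D0 zS.
  rewrite -lee_fin => /le_trans; apply.
  rewrite !EFinD; apply: leeD; last exact: leeD.
  rewrite lee_fin add0r le_eqVlt; apply/orP; left; apply/eqP; congr Num.max.
  by apply: eq_bigr => i _; rewrite mxE.
rewrite sum_int G_int P_int.
(* As [e] is a unit vector, <e, g> is replaced by one standard Gaussian variable. *)
have -> : Num.sqrt (\sum_(i < N) e i 0 ^+ 2) = 1.
  by rewrite -e1; congr Num.sqrt; apply: eq_bigr => i _; rewrite expr2.
under eq_fun do rewrite add0r mul1r.
rewrite gaussE_pos_part.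
apply: le_trans (leeD (lexx _) (leeD intG1 intG2)) _.
rewrite -!EFinD lee_fin.
have F1 := ler_wpM2l k0 (frob_sub_proj A1 e e1).
have F2 := ler_wpM2l k0 (frob_sub_proj A2 e e1).
have epsE : eps = 2 * (D^-1 * d) by rewrite /d; field; rewrite gt_eqF.
lra.
Qed.
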